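(* In the unidimensional platform game of the context with power rule $\rho_{\rho_m}$, suppose that for some type $m$, $\sum_{i<m}s_i<\frac12<\sum_{i\le m}s_i$. Then, as $\rho_m\to\bar\rho^-$, $$X^\star_{\rho_m}\to x_m\ \text{ a.s.},\qquad \mathrm{Var}(X^\star_{\rho_m})\to0,\qquad \mathcal W^\star(\rho_m)\to\mathcal W(x^o)-(x_m-x^o)^2.$$ Hence, if $x_m=x^o$, then $\lim_{\rho_m\to\bar\rho^-}\mathcal W^\star(\rho_m)=\mathcal W(x^o)$.
   Context: There are $N\ge2$ voter types with bliss points $x_1<\cdots<x_N$ in $\mathbb R$ and shares $s_i>0$, $\sum_is_i=1$; type $i$'s utility from policy $x$ is $v(x,x_i)=-(x-x_i)^2$. Parties $A,B$ simultaneously choose platforms in $[x_1,x_N]$. Let $\Delta_i(x_A,x_B)=(x_B-x_i)^2-(x_A-x_i)^2$. A common shock $\epsilon$ is uniform on $[-\phi,\phi]$ with $\phi>\max_{a,b\in[x_1,x_N],\,i}|\Delta_i(a,b)|$. Party $A$'s vote share is $s_A(x_A,x_B,\epsilon)=\sum_is_i\mathbf 1\{\Delta_i(x_A,x_B)\ge\epsilon\}$ and $B$'s is $1-s_A$. For fixed $\bar\rho>0$ and $\rho_m\in[0,\bar\rho)$ the power rule is $\rho_{\rho_m}(s)=(\bar\rho-\rho_m)s$ for $s<\frac12$, $\rho_{\rho_m}(\frac12)=\frac{\bar\rho}2$, and $\rho_{\rho_m}(s)=(\bar\rho-\rho_m)s+\rho_m$ for $s>\frac12$. The function $U:[0,\bar\rho]\to\mathbb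 R$ is fixed, continuous, strictly increasing and strictly concave, with $U(\bar\rho)-U(0)=1$; $\nu=U\circ\rho_{\rho_m}$ and each party's payoff is the expectation over $\epsilon$ of $\nu$ evaluated at its vote share. Equilibrium: with $\underline s_i=\sum_{j\le i}s_j$, $\bar s_i=\sum_{j\ge i}s_j$, $\underline s_0=\bar s_{N+1}=0$, the pure-strategy equilibrium platforms (unique up to party labels) are $\underline x(\rho_m)=\sum_i[\nu(\underline s_i)-\nu(\underline s_{i-1})]x_i<\bar x(\rho_m)=\sum_i[\nu(\bar s_i)-\nu(\bar s_{i+1})]x_i$; let $x_A=\bar x(\rho_m)$, $x_B=\underline x(\rho_m)$. Implemented policy: with $r(s)=\rho_{\rho_m}(s)/\bar\rho$, $X^\star_{\rho_m}(\epsilon)=r(s_A)\,\bar x(\rho_m)+r(1-s_A)\,\underline x(\rho_m)$, where $s_A=s_A(\bar x(\rho_m),\underline x(\rho_m),\epsilon)$. Welfare: $\mathcal W(x)=\sum_is_iv(x,x_i)$, $x^o=\sum_is_ix_i$ (its maximizer), and $\mathcal W^\star(\rho_m)=\mathbb E_\epsilon[\mathcal W(X^\star_{\rho_m}(\epsilon))]$. *)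

(* Defs.v *)
From HB Require Import structures.
From mathcomp Require Import all_boot all_order all_algebra.
From mathcomp Require Import all_classical all_reals all_analysis.
From mathcomp Require Import ring lra.
Set Implicit Arguments.
Unset Strict Implicit.
Unset Printing Implicit Defensive.
Import Order.TTheory GRing.Theory Num.Theory.
Import numFieldNormedType.Exports.
Local Open Scope classical_set_scope.
Local Open Scope ring_scope.

(* Voter types are indexed by 'I_n.+1, so the number of types is N = n.+1 and
   type i of the usual numbering 1, ..., N is the ordinal i - 1. *)

Definition strictly_concave_on (R : realType) (a b : R) (U : R -> R) : Prop :=
  forall y z t : R, y \in `[a, b] -> z \in `[a, b] -> y != z -> 0 < t < 1 ->
    t * U y + (1 - t) * U z < U (t * y + (1 - t) * z).

Definition utility (R : realType) (y z : R) : R := - (y - z) ^+ 2.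

Definition Delta (R : realType) (n : nat) (x : 'I_n.+1 -> R) (i : 'I_n.+1)
  (a b : R) : R := (b - x i) ^+ 2 - (a - x i) ^+ 2.

Definition is_uniform (R : realType) (d : measure_display)
    (Omega : measurableType d) (P : probability Omega R)
    (eps : {RV P >-> R}) (a b : R) : Prop :=
  exists ab : a < b,
    forall A : set R, measurable A -> distribution P eps A = uniform_prob ab A.

Definition vote_share (R : realType) (n : nat) (x s : 'I_n.+1 -> R)
  (a b e : R) : R := \sum_(i < n.+1) s i * (e <= Delta x i a b)%R%:R.

Definition power_rule (R : realType) (rhobar rm t : R) : R :=
  if t < 2^-1 then (rhobar - rm) * t
  else if t == 2^-1 then rhobar / 2
  else (rhobar - rm) * t + rm.

Definition nu (R : realType) (U : R -> R) (rhobar rm t : R) : R :=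
  U (power_rule rhobar rm t).

Definition payoffA (R : realType) (n : nat) (x s : 'I_n.+1 -> R) (U : R -> R)
    (rhobar rm : R) (d : measure_display) (Omega : measurableType d)
    (P : probability Omega R) (eps : {RV P >-> R}) (a b : R) : \bar R :=
  ('E_P[(fun w => nu U rhobar rm (vote_share x s a b (eps w)))%R])%E.

Definition payoffB (R : realType) (n : nat) (x s : 'I_n.+1 -> R) (U : R -> R)
    (rhobar rm : R) (d : measure_display) (Omega : measurableType d)
    (P : probability Omega R) (eps : {RV P >-> R}) (a b : R) : \bar R :=
  ('E_P[(fun w => nu U rhobar rm (1 - vote_share x s a b (eps w)))%R])%E.

Definition is_equilibrium (R : realType) (n : nat) (x s : 'I_n.+1 -> R)
    (U : R -> R) (rhobar rm : R) (d : measure_display)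
    (Omega : measurableType d) (P : probability Omega R)
    (eps : {RV P >-> R}) (a b : R) : Prop :=
  [/\ a \in `[x ord0, x ord_max], b \in `[x ord0, x ord_max],
      (forall a', a' \in `[x ord0, x ord_max] ->
        (payoffA x s U rhobar rm eps a' b <= payoffA x s U rhobar rm eps a b)%E)
    & (forall b', b' \in `[x ord0, x ord_max] ->
        (payoffB x s U rhobar rm eps a b' <= payoffB x s U rhobar rm eps a b)%E)].

(* With types numbered from 0, the share of types j <= i is
   [share_below s i.+1] and the share of types j >= i is [share_from s i];
   the conventions for the empty sums are automatic. *)
Definition share_below (R : realType) (n : nat) (s : 'I_n.+1 -> R) (k : nat) : R :=
  \sum_(j < n.+1 | (j < k)%N) s j.

Definition share_from (R : realType) (n : nat) (s : 'I_n.+1 -> R) (k : nat) : R :=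
  \sum_(j < n.+1 | (k <= j)%N) s j.

Definition platform_low (R : realType) (n : nat) (x s : 'I_n.+1 -> R)
    (U : R -> R) (rhobar rm : R) : R :=
  \sum_(i < n.+1) (nu U rhobar rm (share_below s i.+1)
                   - nu U rhobar rm (share_below s i)) * x i.

Definition platform_high (R : realType) (n : nat) (x s : 'I_n.+1 -> R)
    (U : R -> R) (rhobar rm : R) : R :=
  \sum_(i < n.+1) (nu U rhobar rm (share_from s i)
                   - nu U rhobar rm (share_from s i.+1)) * x i.

Definition implemented_policy (R : realType) (n : nat) (x s : 'I_n.+1 -> R)
    (U : R -> R) (rhobar rm e : R) : R :=
  let hi := platform_high x s U rhobar rm in
  let lo := platform_low x s U rhobar rm in
  let sA := vote_share x s hi lo e in
  power_rule rhobar rm sA / rhobar * hi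
  + power_rule rhobar rm (1 - sA) / rhobar * lo.

Definition welfare (R : realType) (n : nat) (x s : 'I_n.+1 -> R) (y : R) : R :=
  \sum_(i < n.+1) s i * utility y (x i).

Definition xopt (R : realType) (n : nat) (x s : 'I_n.+1 -> R) : R :=
  \sum_(i < n.+1) s i * x i.

Definition expected_welfare (R : realType) (n : nat) (x s : 'I_n.+1 -> R)
    (U : R -> R) (rhobar rm : R) (d : measure_display)
    (Omega : measurableType d) (P : probability Omega R)
    (eps : {RV P >-> R}) : \bar R :=
  ('E_P[(fun w => welfare x s (implemented_policy x s U rhobar rm (eps w)))%R])%E.

(* In particular [xopt] is the unique maximizer of [welfare]. *)
Lemma welfare_xopt (R : realType) (n : nat) (x s : 'I_n.+1 -> R) (y : R) :
  \sum_(i < n.+1) s i = 1 ->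
  welfare x s y = welfare x s (xopt x s) - (y - xopt x s) ^+ 2.
Proof.
move=> s1; set c := xopt x s.
suff e z : welfare x s z = \sum_(i < n.+1) s i * - (x i) ^+ 2 - z ^+ 2 + 2 * z * c.
  by rewrite !e; ring.
transitivity (\sum_(i < n.+1) (s i * - (x i) ^+ 2 - z ^+ 2 * s i
   + 2 * z * (s i * x i))).
  by apply: eq_bigr => i _; rewrite /utility; ring.
by rewrite !big_split /= sumrN -!mulr_sumr s1 mulr1.
Qed.

Lemma uniform_le (R : realType) (d : measure_display)
    (Omega : measurableType d) (P : probability Omega R)
    (eps : {RV P >-> R}) (phi t : R) :
  is_uniform eps (- phi) phi -> `|t| < phi ->
  P [set w | eps w <= t] = ((phi + t) / (2 * phi))%:E.
Proof.
move=> [ab /(_ `]-oo, t]%classic (measurable_itv _)) h] tphi.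
have phi0 : 0 < phi by apply: le_lt_trans tphi.
have /andP[t1 t2] : - phi < t < phi by rewrite -ltr_norml.
have -> : [set w | eps w <= t] = eps @^-1` `]-oo, t]%classic.
  by apply/seteqP; split => w /=; rewrite in_itv.
transitivity (distribution P eps `]-oo, t]%classic); first by [].
rewrite h /uniform_prob integral_uniform_pdf.
have -> : `]-oo, t]%classic `&` `[- phi, phi]%classic = `[- phi, t]%classic.
  apply/seteqP; split => y /=; rewrite !in_itv /=.
    by move=> [yt /andP[-> _]]; rewrite yt.
  by move=> /andP[-> yt]; split=> //; rewrite (le_trans yt (ltW t2)).
rewrite (eq_integral (cst ((phi - - phi)^-1)%:E)); last first.
  move=> y; rewrite inE /= in_itv /= => /andP[y1 y2].
  by rewrite /uniform_pdf y1 (le_trans y2 (ltW t2)).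
rewrite integral_cst//. rewrite /=  lebesgue_measure_itv /= lte_fin t1 -EFinD -EFinM.
by congr (_%:E); field; lra.
Qed.

Lemma expectation_steps (R : realType) (n : nat) (d : measure_display)
    (Omega : measurableType d) (P : probability Omega R)
    (eps : {RV P >-> R}) (phi c : R) (u t : 'I_n.+1 -> R) :
  is_uniform eps (- phi) phi -> (forall i, `|t i| < phi) ->
  ('E_P[(fun w => c + \sum_(i < n.+1) u i * (eps w <= t i)%R%:R)%R])%E
  = (c + \sum_(i < n.+1) u i * ((phi + t i) / (2 * phi)))%:E.
Proof.
move=> heps ht.
have mA i : measurable [set w | eps w <= t i].
  have -> : [set w | eps w <= t i] = eps @^-1` `]-oo, t i].
    by apply/seteqP; split => w /=; rewrite in_itv.
  by rewrite -[X in measurable X]setTI; exact: measurable_funP.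
pose F i : Omega -> R := u i \o* \1_[set w | eps w <= t i].
have L i : F i \in Lfun P 1.
  apply/Lfun1_integrable.
  rewrite (_ : _ \o _ = (fun w => (u i)%:E * (\1_[set w | eps w <= t i] w)%:E)%E).
    apply: integrableZl => //; apply: integrable_indic => //.
  by apply/funext => w /=; rewrite -EFinM mulrC.
rewrite (_ : (fun w => _) =
    \sum_(G <- cst c :: [seq F i | i <- index_enum 'I_n.+1]) G); last first.
  apply/funext => w; rewrite big_cons big_map /= fct_sumE.
  congr (c + _); apply: eq_bigr => i _; rewrite /F /= mulrC indicE.
  congr (_%:R * _); case: (boolP (_ <= _)) => H.
    by rewrite mem_set.
  by rewrite memNset //=; apply/negP.
rewrite expectation_sum; last first.
  move=> G; rewrite inE => /orP[/eqP->|/mapP[i _ ->]//].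
  exact: Lfun_cst.
rewrite big_cons big_map expectation_cst EFinD -sumEFin; congr (_ + _)%E.
apply: eq_bigr => i _.
rewrite /F expectationZl; last first.
  apply/Lfun1_integrable; exact: integrable_indic.
by rewrite expectation_indic// (uniform_le heps (ht i)) EFinM.
Qed.

Lemma share_below_from (R : realType) (n : nat) (s : 'I_n.+1 -> R) k :
  \sum_(i < n.+1) s i = 1 -> share_below s k = 1 - share_from s k.
Proof.
move=> <-; rewrite /share_below /share_from.
rewrite [\sum_(i < n.+1) s i](bigID (fun j : 'I_n.+1 => (j < k)%N)) /=.
by under [in X in _ = _ - X]eq_bigl do rewrite leqNgt; rewrite addrK.
Qed.

Lemma share_from0 (R : realType) (n : nat) (s : 'I_n.+1 -> R) :
  share_from s 0 = \sum_(i < n.+1) s i.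
Proof. by []. Qed.

Lemma share_fromN (R : realType) (n : nat) (s : 'I_n.+1 -> R) :
  share_from s n.+1 = 0.
Proof. by rewrite /share_from big1// => i; rewrite leqNgt ltn_ord. Qed.

Lemma telescope_from (R : realType) (f : nat -> R) (N k : nat) :
  (k <= N)%N -> \sum_(i < N) (f i - f i.+1) * (k <= i)%N%:R = f k - f N.
Proof.
elim: N => [|N IH]; first by rewrite leqn0 => /eqP ->; rewrite big_ord0 subrr.
rewrite leq_eqVlt => /orP[/eqP ->|].
  rewrite subrr big1// => i _; rewrite leqNgt ltn_ord mulr0 //.
by rewrite ltnS => kN; rewrite big_ord_recr /= IH// kN mulr1 addrA subrK.
Qed.

Lemma telescope_below (R : realType) (f : nat -> R) (N k : nat) :
  (k <= N)%N -> \sum_(i < N) (f i.+1 - f i) * (i < k)%N%:R = f k - f 0%N.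
Proof.
elim: N => [|N IH]; first by rewrite leqn0 => /eqP ->; rewrite big_ord0 subrr.
rewrite leq_eqVlt => /orP[/eqP ->|].
  rewrite (eq_bigr (fun i : 'I_N.+1 => f i.+1 - f i)); last first.
    by move=> i _; rewrite ltn_ord mulr1.
  by rewrite -(big_mkord xpredT (fun i => f i.+1 - f i)) telescope_sumr.
rewrite ltnS => kN; rewrite big_ord_recr /= IH//.
by rewrite ltnNge kN mulr0 addr0.
Qed.

Lemma thr_from (R : realType) (N : nat) (t : 'I_N -> R) (e : R) :
  (forall i j : 'I_N, (i <= j)%N -> t i <= t j) ->
  exists2 k, (k <= N)%N & forall i : 'I_N, (e <= t i) = (k <= i)%N.
Proof.
elim: N t => [|N IH] t ht; first by exists 0%N => // -[].
have [|k kN hk] := IH (fun i => t (widen_ord (leqnSn N) i)).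
  by move=> i j ij; apply: ht.
have [et|et] := leP e (t ord_max); last first.
  exists N.+1 => // i; rewrite leqNgt ltn_ord; apply/negbTE.
  by rewrite -ltNge (le_lt_trans _ et)// ht// -ltnS.
exists k; first exact: leqW.
move=> i; have [iN|Ni] := ltnP i N.
  by rewrite -(hk (Ordinal iN)); congr (_ <= t _); apply: val_inj.
have -> : i = ord_max by apply: val_inj; apply/eqP; rewrite eqn_leq -ltnS ltn_ord.
by rewrite et kN.
Qed.

Lemma thr_below (R : realType) (N : nat) (t : 'I_N -> R) (e : R) :
  (forall i j : 'I_N, (i <= j)%N -> t j <= t i) ->
  exists2 k, (k <= N)%N & forall i : 'I_N, (e <= t i) = (i < k)%N.
Proof.
elim: N t => [|N IH] t ht; first by exists 0%N => // -[].
have [|k kN hk] := IH (fun i => t (widen_ord (leqnSn N) i)).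
  by move=> i j ij; apply: ht.
have [et|et] := leP e (t ord_max).
  exists N.+1 => // i; rewrite ltn_ord.
  by rewrite (le_trans et)// ht// -ltnS.
exists k; first exact: leqW.
move=> i; have [iN|Ni] := ltnP i N.
  by rewrite -(hk (Ordinal iN)); congr (_ <= t _); apply: val_inj.
have -> : i = ord_max by apply: val_inj; apply/eqP; rewrite eqn_leq -ltnS ltn_ord.
by rewrite leNgt et /= ltnNge kN.
Qed.

Lemma steps_from (R : realType) (n : nat) (s t : 'I_n.+1 -> R) (g : R -> R)
    (e : R) :
  (forall i j : 'I_n.+1, (i <= j)%N -> t i <= t j) ->
  g (\sum_(i < n.+1) s i * (e <= t i)%R%:R) =
  g 0 + \sum_(i < n.+1)
     (g (share_from s i) - g (share_from s i.+1)) * (e <= t i)%R%:R.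
Proof.
move=> /(thr_from e)[k kn hk].
under [X in g X]eq_bigr do rewrite hk mulr_natr mulrb.
under [X in _ + X]eq_bigr do rewrite hk.
rewrite -big_mkcond /= (telescope_from (fun i => g (share_from s i)) kn).
by rewrite share_fromN addrC subrK.
Qed.

Lemma steps_below (R : realType) (n : nat) (s t : 'I_n.+1 -> R) (g : R -> R)
    (e : R) :
  (forall i j : 'I_n.+1, (i <= j)%N -> t j <= t i) ->
  g (\sum_(i < n.+1) s i * (e <= t i)%R%:R) =
  g 0 + \sum_(i < n.+1)
     (g (share_below s i.+1) - g (share_below s i)) * (e <= t i)%R%:R.
Proof.
move=> /(thr_below e)[k kn hk].
under [X in g X]eq_bigr do rewrite hk mulr_natr mulrb.
under [X in _ + X]eq_bigr do rewrite hk.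
rewrite -big_mkcond /= (telescope_below (fun i => g (share_below s i)) kn).
by rewrite [share_below s 0]big_pred0// addrC subrK.
Qed.

Lemma Delta_le (R : realType) (n : nat) (x : 'I_n.+1 -> R) (a b : R) :
  (forall i j : 'I_n.+1, (i < j)%N -> x i < x j) -> b <= a ->
  forall i j : 'I_n.+1, (i <= j)%N -> Delta x i a b <= Delta x j a b.
Proof.
move=> hx ba i j; rewrite leq_eqVlt => /orP[/eqP/val_inj ->//|/hx ij].
by rewrite /Delta; nra.
Qed.

Lemma Delta_ge (R : realType) (n : nat) (x : 'I_n.+1 -> R) (a b : R) :
  (forall i j : 'I_n.+1, (i < j)%N -> x i < x j) -> a <= b ->
  forall i j : 'I_n.+1, (i <= j)%N -> Delta x j a b <= Delta x i a b.
Proof.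
move=> hx ba i j; rewrite leq_eqVlt => /orP[/eqP/val_inj ->//|/hx ij].
by rewrite /Delta; nra.
Qed.

Lemma sum_weights_Delta (R : realType) (n : nat) (x u : 'I_n.+1 -> R)
    (phi a b : R) : 0 < phi -> \sum_(i < n.+1) u i = 1 ->
  \sum_(i < n.+1) u i * ((phi + Delta x i a b) / (2 * phi)) =
  2^-1 + ((b - \sum_(i < n.+1) u i * x i) ^+ 2
          - (a - \sum_(i < n.+1) u i * x i) ^+ 2) / (2 * phi).
Proof.
move=> phi0 u1; set c := \sum_(i < n.+1) u i * x i.
transitivity (\sum_(i < n.+1) ((2^-1 + (b ^+ 2 - a ^+ 2) / (2 * phi)) * u i
   + (a - b) / phi * (u i * x i))).
  by apply: eq_bigr => i _; rewrite /Delta; field; lra.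
rewrite big_split /= -!mulr_sumr u1 -/c; field; lra.
Qed.

Lemma power_rule0 (R : realType) (rhobar rm : R) : power_rule rhobar rm 0 = 0.
Proof. by rewrite /power_rule invr_gt0 ltr0n mulr0. Qed.

Lemma power_rule1 (R : realType) (rhobar rm : R) : power_rule rhobar rm 1 = rhobar.
Proof.
rewrite /power_rule ifF; last by apply/negbTE; rewrite -leNgt; lra.
by rewrite ifF; [lra | apply/negbTE/eqP; lra].
Qed.

Lemma power_rule_lt (R : realType) (rhobar rm y z : R) :
  0 <= rm < rhobar -> y < z -> power_rule rhobar rm y < power_rule rhobar rm z.
Proof.
move=> /andP[rm0 rmr] yz; rewrite /power_rule.
by case: (ltgtP y) => hy; case: (ltgtP z) => hz; nra.
Qed.

Lemma power_rule_le (R : realType) (rhobar rm y z : R) :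
  0 <= rm < rhobar -> y <= z -> power_rule rhobar rm y <= power_rule rhobar rm z.
Proof.
move=> h; rewrite le_eqVlt => /orP[/eqP -> //|yz].
exact/ltW/power_rule_lt.
Qed.

Lemma power_rule_itv (R : realType) (rhobar rm y : R) :
  0 <= rm < rhobar -> 0 <= y <= 1 -> power_rule rhobar rm y \in `[0, rhobar].
Proof.
move=> h /andP[y0 y1]; rewrite in_itv /=.
rewrite -{1}(power_rule0 rhobar rm) (power_rule_le h y0) /=.
by rewrite (le_trans (power_rule_le h y1))// power_rule1.
Qed.

Lemma power_ruleC (R : realType) (rhobar rm y : R) :
  power_rule rhobar rm y + power_rule rhobar rm (1 - y) = rhobar.
Proof.
rewrite /power_rule.
by case: (ltgtP y) => hy; case: (ltgtP (1 - y)) => hz; lra.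
Qed.

Lemma share_belowS (R : realType) (n : nat) (s : 'I_n.+1 -> R) (i : 'I_n.+1) :
  share_below s i.+1 = share_below s i + s i.
Proof.
rewrite /share_below (bigD1 i)//= addrC; congr (_ + _).
apply: eq_bigl => j; rewrite ltnS leq_eqVlt -val_eqE /=.
by case: (ltngtP j i).
Qed.

Lemma share_below_mono (R : realType) (n : nat) (s : 'I_n.+1 -> R) (k l : nat) :
  (forall i, 0 < s i) -> (k <= l)%N -> share_below s k <= share_below s l.
Proof.
move=> s0 kl; rewrite /share_below big_mkcond [leRHS]big_mkcond.
apply: ler_sum => j _; case: ltnP => jk; last by case: ifP => // _; exact: ltW.
by rewrite (leq_trans jk kl).
Qed.

Lemma share_below_itv (R : realType) (n : nat) (s : 'I_n.+1 -> R) (k : nat) :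
  (forall i, 0 < s i) -> \sum_(i < n.+1) s i = 1 -> 0 <= share_below s k <= 1.
Proof.
move=> s0 <-; apply/andP; split; first by apply: sumr_ge0 => i _; exact: ltW.
rewrite /share_below big_mkcond; apply: ler_sum => j _.
by case: ifP => // _; exact: ltW.
Qed.

Lemma abel (R : realType) (n : nat) (h : nat -> R) (x : nat -> R) :
  h 0%N = 0 -> h n.+1 = 0 ->
  \sum_(i < n.+1) (h i - h i.+1) * x i =
  \sum_(i < n) h i.+1 * (x i.+1 - x i).
Proof.
move=> h0 hn.
under eq_bigr do rewrite mulrBl; rewrite sumrB.
rewrite big_ord_recl /= h0 mul0r add0r.
rewrite [X in _ - X]big_ord_recr /= hn mul0r addr0 -sumrB.
by apply: eq_bigr => i _; rewrite mulrBr.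
Qed.

Lemma convex_comb_itv (R : realType) (n : nat) (x u : 'I_n.+1 -> R) :
  (forall i j : 'I_n.+1, (i < j)%N -> x i < x j) ->
  (forall i, 0 <= u i) -> \sum_(i < n.+1) u i = 1 ->
  \sum_(i < n.+1) u i * x i \in `[x ord0, x ord_max].
Proof.
move=> hx u0 u1.
have hx' (i j : 'I_n.+1) : (i <= j)%N -> x i <= x j.
  by rewrite leq_eqVlt => /orP[/eqP/val_inj ->//|/hx/ltW].
rewrite in_itv /=; apply/andP; split.
  rewrite -[leLHS]mul1r -u1 mulr_suml; apply: ler_sum => i _.
  by apply: ler_wpM2l => //; apply: hx'.
rewrite -[leRHS]mul1r -u1 mulr_suml; apply: ler_sum => i _.
by apply: ler_wpM2l => //; apply: hx'; rewrite -ltnS.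
Qed.

(* The closed-form platforms are, up to exchanging the parties, the
   only pure-strategy equilibrium of the game. *)
Lemma equilibrium_platforms (R : realType) (n : nat) (hn : (2 <= n.+1)%N)
    (x s : 'I_n.+1 -> R)
    (hx : forall i j : 'I_n.+1, (i < j)%N -> x i < x j)
    (hs : forall i, 0 < s i) (hs1 : \sum_(i < n.+1) s i = 1)
    (phi : R)
    (hphi : forall a b i, a \in `[x ord0, x ord_max] ->
       b \in `[x ord0, x ord_max] -> `|Delta x i a b| < phi)
    (d : measure_display) (Omega : measurableType d) (P : probability Omega R)
    (eps : {RV P >-> R}) (heps : is_uniform eps (- phi) phi)
    (rhobar rm : R) (hrm : 0 <= rm < rhobar) (U : R -> R)
    (hUi : forall y z, y \in `[0, rhobar] -> z \in `[0, rhobar] ->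
       y < z -> U y < U z)
    (hUv : strictly_concave_on 0 rhobar U)
    (hU1 : U rhobar - U 0 = 1) :
  let hi := platform_high x s U rhobar rm in
  let lo := platform_low x s U rhobar rm in
  lo < hi /\
  forall a b, is_equilibrium x s U rhobar rm eps a b <->
    (a = hi /\ b = lo) \/ (a = lo /\ b = hi).
Proof.
move=> hi lo.
set V := nu U rhobar rm.
have bf k : share_below s k = 1 - share_from s k by exact: share_below_from.
have fb k : share_from s k = 1 - share_below s k by rewrite bf; lra.
have V0 : V 0 = U 0 by rewrite /V /nu power_rule0.
have V1 : V 1 = U rhobar by rewrite /V /nu power_rule1.
have Vle y z : 0 <= y -> y <= z -> z <= 1 -> V y <= V z.
  move=> y0; rewrite le_eqVlt => /orP[/eqP -> //|yz] z1.
  apply/ltW/hUi; last exact: power_rule_lt.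
    by apply: power_rule_itv => //; rewrite y0 (le_trans (ltW yz)).
  by apply: power_rule_itv => //; rewrite z1 (le_trans y0 (ltW yz)).
have B0 : share_below s 0 = 0 by rewrite /share_below big_pred0.
have B1 : share_below s n.+1 = 1 by rewrite bf share_fromN subr0.
pose wl i : R := V (share_below s i.+1) - V (share_below s i).
pose wh i : R := V (share_from s i) - V (share_from s i.+1).
have wl0 (i : 'I_n.+1) : 0 <= wl i.
  have /andP[p0 p1] := share_below_itv i hs hs1.
  have /andP[q0 q1] := share_below_itv i.+1 hs hs1.
  by rewrite subr_ge0; apply: Vle => //; exact: share_below_mono.
have wh0 (i : 'I_n.+1) : 0 <= wh i.
  have /andP[p0 p1] := share_below_itv i hs hs1.
  have /andP[q0 q1] := share_below_itv i.+1 hs hs1.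
  have := share_below_mono hs (leqnSn i).
  by rewrite subr_ge0 !fb => ?; apply: Vle => //; lra.
have wl1 : \sum_(i < n.+1) wl i = 1.
  rewrite -(big_mkord xpredT wl) (telescope_sumr (fun i => V (share_below s i)))//.
  by rewrite B0 B1 V0 V1.
have wh1 : \sum_(i < n.+1) wh i = 1.
  have := telescope_from (fun i => V (share_from s i)) (leq0n n.+1).
  rewrite /= share_fromN fb B0 subr0 V0 V1 hU1 => <-.
  by apply: eq_bigr => i _; rewrite mulr1.
have loE : lo = \sum_(i < n.+1) wl i * x i by [].
have hiE : hi = \sum_(i < n.+1) wh i * x i by [].
have loI : lo \in `[x ord0, x ord_max] by rewrite loE; exact: convex_comb_itv.
have hiI : hi \in `[x ord0, x ord_max] by rewrite hiE; exact: convex_comb_itv.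
have phi0 : 0 < phi.
  by apply: le_lt_trans (hphi _ _ ord0 loI loI).
have lohi : lo < hi.
  rewrite -subr_gt0 hiE loE -sumrB.
  pose h k := V (share_from s k) + V (share_below s k) - (V 0 + V 1).
  pose xx k := x (inord k).
  rewrite (eq_bigr (fun i : 'I_n.+1 => (h i - h i.+1) * xx i)); last first.
    by move=> i _; rewrite /h /xx inord_val /wh /wl; lra.
  rewrite abel; last 2 first.
  - by rewrite /h B0 fb B0 subr0; lra.
  - by rewrite /h B1 fb B1 subrr; lra.
  have hpos (i : 'I_n) : 0 < h i.+1 * (xx i.+1 - xx i).
    apply: mulr_gt0; last first.
      rewrite subr_gt0 /xx; apply: hx.
      by rewrite !inordK// ltnS// ltnW.
    have iN : (i.+1 < n.+1)%N by rewrite ltnS.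
    have s0 : 0 < share_below s i.+1.
      have -> : i.+1 = (widen_ord (leqnSn n) i).+1 by [].
      rewrite share_belowS ltr_wpDl//.
      by have /andP[] := share_below_itv (widen_ord (leqnSn n) i) hs hs1.
    have s1 : share_below s i.+1 < 1.
      apply: (@lt_le_trans _ _ (share_below s i.+2)).
        by rewrite (share_belowS s (Ordinal iN)) /= ltrDl.
      by have /andP[] := share_below_itv i.+2 hs hs1.
    rewrite /h fb; set y := share_below s i.+1 in s0 s1 *.
    rewrite V0 V1 /V /nu.
    have r0 : 0 < rhobar by case/andP: hrm => ? ?; lra.
    have p0 := power_rule_lt hrm s0.
    have p1 := power_rule_lt hrm s1.
    have pC := power_ruleC rhobar rm y.
    rewrite power_rule0 in p0; rewrite power_rule1 in p1.
    have -> : power_rule rhobar rm (1 - y) = rhobar - power_rule rhobar rm y by lra.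
    set q := power_rule _ _ _ in p0 p1 *.
    pose t := q / rhobar.
    have t0 : 0 < t by exact: divr_gt0.
    have t1 : t < 1 by rewrite /t ltr_pdivrMr ?mul1r.
    have qE : t * rhobar = q by rewrite /t divfK// gt_eqF.
    have I0 : (0 : R) \in `[0, rhobar] by rewrite in_itv /= lexx ltW.
    have I1 : rhobar \in `[0, rhobar] by rewrite in_itv /= lexx ltW.
    have n0 : rhobar != 0 by rewrite gt_eqF.
    have t01 : 0 < t < 1 by rewrite t0.
    have t01' : 0 < 1 - t < 1 by lra.
    have C1 := hUv _ _ _ I1 I0 n0 t01.
    have C2 := hUv _ _ _ I1 I0 n0 t01'.
    rewrite mulr0 addr0 qE in C1.
    have qE' : (1 - t) * rhobar = rhobar - q by rewrite mulrBl qE mul1r.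
    rewrite mulr0 addr0 qE' in C2.
    lra.
  have n0 : (0 < n)%N by [].
  rewrite (bigD1 (Ordinal n0))//=.
  apply: ltr_wpDr; last exact: (hpos (Ordinal n0)).
  by apply: sumr_ge0 => i _; exact/ltW.
split=> //.
pose Q (c a b : R) := ((b - c) ^+ 2 - (a - c) ^+ 2) / (2 * phi).
have pA_ge a b : a \in `[x ord0, x ord_max] -> b \in `[x ord0, x ord_max] ->
    b <= a -> payoffA x s U rhobar rm eps a b = (V 0 + (2^-1 + Q hi a b))%:E.
  move=> aI bI ba; rewrite /payoffA /vote_share -/V.
  under [X in ('E_P[X])%E]eq_fun do rewrite (steps_from _ _ _ (Delta_le hx ba)).
  rewrite (expectation_steps _ _ heps); last by move=> i; exact: hphi.
  by rewrite (sum_weights_Delta x a b phi0 wh1).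
have pA_le a b : a \in `[x ord0, x ord_max] -> b \in `[x ord0, x ord_max] ->
    a <= b -> payoffA x s U rhobar rm eps a b = (V 0 + (2^-1 + Q lo a b))%:E.
  move=> aI bI ba; rewrite /payoffA /vote_share -/V.
  under [X in ('E_P[X])%E]eq_fun do rewrite (steps_below _ _ _ (Delta_ge hx ba)).
  rewrite (expectation_steps _ _ heps); last by move=> i; exact: hphi.
  by rewrite (sum_weights_Delta x a b phi0 wl1).
have pB_ge a b : a \in `[x ord0, x ord_max] -> b \in `[x ord0, x ord_max] ->
    b <= a -> payoffB x s U rhobar rm eps a b = (V 1 - (2^-1 + Q lo a b))%:E.
  move=> aI bI ba; rewrite /payoffB /vote_share -/V.
  under [X in ('E_P[X])%E]eq_fun do
    rewrite (steps_from _ (fun t => V (1 - t)) _ (Delta_le hx ba)).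
  rewrite (expectation_steps _ _ heps); last by move=> i; exact: hphi.
  rewrite -(sum_weights_Delta x a b phi0 wl1) subr0 -sumrN; congr (_ + _)%:E.
  by apply: eq_bigr => i _; rewrite -!bf -mulNr opprB.
have pB_le a b : a \in `[x ord0, x ord_max] -> b \in `[x ord0, x ord_max] ->
    a <= b -> payoffB x s U rhobar rm eps a b = (V 1 - (2^-1 + Q hi a b))%:E.
  move=> aI bI ba; rewrite /payoffB /vote_share -/V.
  under [X in ('E_P[X])%E]eq_fun do
    rewrite (steps_below _ (fun t => V (1 - t)) _ (Delta_ge hx ba)).
  rewrite (expectation_steps _ _ heps); last by move=> i; exact: hphi.
  rewrite -(sum_weights_Delta x a b phi0 wh1) subr0 -sumrN; congr (_ + _)%:E.
  by apply: eq_bigr => i _; rewrite -!fb -mulNr opprB.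
have Q2 (c a b c' a' b' : R) :
    (Q c a b <= Q c' a' b') =
    ((b - c) ^+ 2 - (a - c) ^+ 2 <= (b' - c') ^+ 2 - (a' - c') ^+ 2).
  by rewrite /Q ler_pM2r// invr_gt0 mulr_gt0.
have A1 c a b c' a' b' : ((V 0 + (2^-1 + Q c a b))%:E <= (V 0 + (2^-1 + Q c' a' b'))%:E)%E
   = ((b - c) ^+ 2 - (a - c) ^+ 2 <= (b' - c') ^+ 2 - (a' - c') ^+ 2).
  by rewrite lee_fin !lerD2l Q2.
have A2 c a b c' a' b' : ((V 1 - (2^-1 + Q c a b))%:E <= (V 1 - (2^-1 + Q c' a' b'))%:E)%E
   = ((b' - c') ^+ 2 - (a' - c') ^+ 2 <= (b - c) ^+ 2 - (a - c) ^+ 2).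
  by rewrite lee_fin lerD2l lerN2 lerD2l Q2.
have lh := ltW lohi.
have eqsq (y z : R) : (y - z) ^+ 2 <= 0 -> y = z.
  by move=> H; apply/eqP; rewrite -subr_eq0 -sqrf_eq0 eq_le H sqr_ge0.
move=> a b; split.
- move=> [aI bI hA hB]; have [ba|ab] := leP b a.
  + left.
    have [bh|hb] := leP b hi; last first.
      have lb : lo < b by exact: lt_trans hb.
      move: (hA lo loI); rewrite (pA_ge a b)// (pA_le lo b)// ?A1; last exact: ltW.
      nra.
    have ahi : a = hi.
      move: (hA hi hiI); rewrite (pA_ge a b)// (pA_ge hi b)// A1 => H.
      by apply: eqsq; lra.
    split=> //; subst a.
    move: (hB lo loI); rewrite (pB_ge hi b)// (pB_ge hi lo)// A2 => H.
    by apply: eqsq; lra.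
  + right; have ab' := ltW ab.
    have [lb|bl] := leP lo b; last first.
      have bh : b <= hi by exact: (le_trans (ltW bl)).
      move: (hA hi hiI); rewrite (pA_le a b)// (pA_ge hi b)// A1.
      nra.
    have alo : a = lo.
      move: (hA lo loI); rewrite (pA_le a b)// (pA_le lo b)// A1 => H.
      by apply: eqsq; lra.
    split=> //; subst a.
    move: (hB hi hiI); rewrite (pB_le lo b)// (pB_le lo hi)// A2 => H.
    by apply: eqsq; lra.
- case=> -[-> ->]; split=> //.
  + move=> a' a'I.
    have := sqr_ge0 (a' - hi); have := sqr_ge0 (a' - lo); have := sqr_ge0 (hi - lo).
    rewrite (pA_ge hi lo)//.
    by have [|/ltW] := leP lo a' => h; [rewrite pA_ge// A1 | rewrite pA_le// A1]; nra.
  + move=> b' b'I.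
    have := sqr_ge0 (b' - hi); have := sqr_ge0 (b' - lo); have := sqr_ge0 (hi - lo).
    rewrite (pB_ge hi lo)//.
    by have [|/ltW] := leP b' hi => h; [rewrite pB_ge// A2 | rewrite pB_le// A2]; nra.
  + move=> a' a'I.
    have := sqr_ge0 (a' - hi); have := sqr_ge0 (a' - lo); have := sqr_ge0 (hi - lo).
    rewrite (pA_le lo hi)//.
    by have [|/ltW] := leP a' hi => h; [rewrite pA_le// A1 | rewrite pA_ge// A1]; nra.
  + move=> b' b'I.
    have := sqr_ge0 (b' - hi); have := sqr_ge0 (b' - lo); have := sqr_ge0 (hi - lo).
    rewrite (pB_le lo hi)//.
    by have [|/ltW] := leP lo b' => h; [rewrite pB_le// A2 | rewrite pB_ge// A2]; nra.
Qed.

(* Main.v *)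
Require Import Defs.
From HB Require Import structures.
From mathcomp Require Import all_boot all_order all_algebra.
From mathcomp Require Import all_classical all_reals all_analysis.
From mathcomp Require Import measurable_realfun ring lra.
Set Implicit Arguments.
Unset Strict Implicit.
Unset Printing Implicit Defensive.
Import Order.TTheory GRing.Theory Num.Theory.
Import numFieldNormedType.Exports.
Local Open Scope classical_set_scope.
Local Open Scope ring_scope.

(** As [rm] tends to [rhobar], [nu] tends to the step function equal to [U 0]
    below 1/2 and to [U rhobar] above 1/2.  No cumulated share equals 1/2 and
    both families of cumulated shares cross 1/2 at type [m], so
    both platforms tend to [x m].  The implemented policy always lies between
    the platforms, hence it tends to [x m] uniformly in the shock: the variance
    vanishes, and so does the expected gap between
    [welfare X = welfare (xopt) - (X - xopt)^2] and its value at [x m]. *)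

(** At a point of [A], subspace neighbourhoods are exactly the sets of [within A (nbhs z)]. This
    serves for [U], which is continuous only on [[0, rhobar]]. *)
Lemma within_continuous_cvg (S T : topologicalType) (A : set S) (f : S -> T)
    (z : S) :
  A z -> {within A, continuous f} -> f y @[y --> within A (nbhs z)] --> f z.
Proof. by move=> Az /(_ z); rewrite /continuous_at nbhs_subspace_in. Qed.

(** * Expectation and variance under uniform convergence *)

Lemma expectation_itv (R : realType) (d : measure_display)
    (Omega : measurableType d) (P : probability Omega R) (X : Omega -> R)
    (a b : R) :
  measurable_fun setT X -> (forall w, a <= X w <= b) ->
  (a%:E <= 'E_P[X] <= b%:E)%E.
Proof.
move=> mX Xab.
have L (c : R) : (P.-integrable setT (EFin \o cst c))%E.
  by apply/Lfun1_integrable; exact: Lfun_cst.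
have iX : (P.-integrable setT (EFin \o X))%E.
  apply: measurable_bounded_integrable => //.
    by rewrite -ge0_fin_numE ?fin_num_measure.
  (* A bounded measurable function is integrable for a finite measure; this maximum dominates
     [X]. *)
  exists (Num.max `|a| `|b|); split; first exact: num_real.
  move=> M /ltW; rewrite ge_max => /andP[aM bM] w _ /=.
  by have := Xab w; move: aM bM; rewrite !ler_norml; lra.
have eE c : ('E_P[cst c] = c%:E)%E by exact: expectation_cst.
apply/andP; split.
  rewrite -[leLHS]eE unlock; apply: le_integral => //; [exact: L|] => w _.
  by rewrite lee_fin; case/andP: (Xab w).
rewrite -[leRHS]eE unlock; apply: le_integral => //; [exact: L|] => w _.
by rewrite lee_fin; case/andP: (Xab w).
Qed.

Section uniform_convergence.
Context (R : realType) (d : measure_display) (Omega : measurableType d).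
Context (P : probability Omega R) (T : Type) (F : set_system T) (FF : Filter F).
Variables (X : T -> Omega -> R) (c : R) (D : T -> R).
Hypothesis mX : forall t, measurable_fun setT (X t).
Hypothesis XD : \forall t \near F, forall w, `|X t w - c| <= D t.
Hypothesis D0 : D t @[t --> F] --> 0.

(** The bound [D t] does not depend on the outcome, so the mean is squeezed between [c - D t] and
    [c + D t]. *)
Lemma expectation_cvg : ('E_P[X t])%E @[t --> F] --> c%:E.
Proof.
apply: (@squeeze_cvge _ _ _ _ (fun t => (c - D t)%:E) _
  (fun t => (c + D t)%:E)).
- apply: filterS XD => t Xt; apply: expectation_itv => // w.
  by move: (Xt w); rewrite ler_norml; lra.
- apply: cvg_EFin; first by near=> t.
  rewrite -[in X in _ --> X](subr0 c).
  exact: (cvgB (cvg_cst _) D0).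
- apply: cvg_EFin; first by near=> t.
  rewrite -[in X in _ --> X](addr0 c).
  exact: (cvgD (cvg_cst _) D0).
Unshelve. all: by end_near. Qed.

End uniform_convergence.

(** Both [X t] and its mean lie within [D t] of [c], so the squared deviation is at most
    [(2 * D t) ^+ 2] everywhere, and [expectation_cvg] applies to it with limit 0. *)
Lemma variance_cvg0 (R : realType) (d : measure_display)
    (Omega : measurableType d) (P : probability Omega R) (T : Type)
    (F : set_system T) (FF : Filter F) (X : T -> Omega -> R) (c : R)
    (D : T -> R) :
  (forall t, measurable_fun setT (X t)) ->
  (\forall t \near F, forall w, `|X t w - c| <= D t) ->
  D t @[t --> F] --> 0 -> ('V_P[X t])%E @[t --> F] --> 0%:E.
Proof.
move=> mX XD D0.
rewrite /variance; under eq_fun do rewrite unlock.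
apply: (@expectation_cvg _ _ _ _ _ _ _ _ _ (fun t => (2 * D t) ^+ 2)).
- move=> t; apply: measurable_funM; apply: measurable_funB => //;
    exact: measurable_cst.
- apply: filterS XD => t Xt w.
  have /andP[] : ((c - D t)%:E <= 'E_P[X t] <= (c + D t)%:E)%E.
    by apply: expectation_itv => // w'; move: (Xt w'); rewrite ler_norml; lra.
  (* The finite bounds rule out an infinite mean. *)
  case: ('E_P[X t])%E => [e| |] //; rewrite !lee_fin /= => e1 e2.
  have -> : ((X t \- cst e) * (X t \- cst e)) w - 0 = (X t w - e) ^+ 2.
    exact: subr0.
  rewrite normrX; move: (Xt w); rewrite ler_norml => /andP[x1 x2].
  by apply: lerXn2r; rewrite ?nnegrE ?ler_norml//; lra.
- rewrite [X in _ --> X](_ : _ = (2 * 0) * (2 * 0)); last by rewrite !mulr0.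
  by under eq_fun do rewrite expr2; apply: cvgM; apply: cvgMr.
Qed.

(** * Measurability and range of the implemented policy *)

Lemma measurable_power_rule (R : realType) (rhobar rm : R) :
  measurable_fun setT (power_rule rhobar rm).
Proof.
have mM : measurable_fun setT (fun t : R => (rhobar - rm) * t).
  by apply: measurable_funM => //; exact: measurable_cst.
apply: measurable_fun_ifT; first by apply: measurable_fun_ltr => //; exact: measurable_cst.
- exact: mM.
apply: measurable_fun_ifT; first by apply: measurable_fun_eqr => //; exact: measurable_cst.
- exact: measurable_cst.
- by apply: measurable_funD => //; exact: measurable_cst.
Qed.

Lemma measurable_vote_share (R : realType) (n : nat) (x s : 'I_n.+1 -> R)
    (a b : R) :
  measurable_fun setT (vote_share x s a b).
Proof.
apply: measurable_sum => i; apply: measurable_funM; first exact: measurable_cst.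
rewrite (_ : (fun e : R => _) = fun e => if e <= Delta x i a b then 1 else 0);
  last by apply/funext => e; case: ifP.
by apply: measurable_fun_ifT; [apply: measurable_fun_ler => //| |]; exact: measurable_cst.
Qed.

Lemma measurable_implemented_policy (R : realType) (n : nat)
    (x s : 'I_n.+1 -> R) (U : R -> R) (rhobar rm : R) :
  measurable_fun setT (implemented_policy x s U rhobar rm).
Proof.
have mv a b := measurable_vote_share x s a b.
have mp := measurable_power_rule rhobar rm.
apply: measurable_funD; apply: measurable_funM => //;
  apply: measurable_funM => //; apply: measurableT_comp => //.
by apply: measurable_funB => //.
Qed.

Lemma vote_share_itv (R : realType) (n : nat) (x s : 'I_n.+1 -> R) (a b e : R) :
  (forall i, 0 <= s i) -> \sum_(i < n.+1) s i = 1 ->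
  0 <= vote_share x s a b e <= 1.
Proof.
move=> s0 <-; apply/andP; split.
  by apply: sumr_ge0 => i _; rewrite mulr_ge0.
by apply: ler_sum => i _; rewrite ler_piMr ?lern1 ?leq_b1.
Qed.

(* The two power weights sum to one, so the implemented policy is a convex
   combination of the platforms whatever the shock. *)
Lemma implemented_policy_dist (R : realType) (n : nat) (x s : 'I_n.+1 -> R)
    (U : R -> R) (rhobar rm c e : R) :
  (forall i, 0 <= s i) -> \sum_(i < n.+1) s i = 1 -> 0 <= rm < rhobar ->
  `|implemented_policy x s U rhobar rm e - c| <=
  `|platform_high x s U rhobar rm - c| + `|platform_low x s U rhobar rm - c|.
Proof.
move=> s0 s1 hrm; rewrite /implemented_policy.
set h := platform_high _ _ _ _ _; set l := platform_low _ _ _ _ _.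
have r0 : 0 < rhobar by lra.
have := vote_share_itv x h l e s0 s1; set v := vote_share _ _ _ _ _ => v01.
have /= := power_rule_itv hrm v01; rewrite in_itv /=.
have := power_ruleC rhobar rm v.
set p := power_rule _ _ v => pq p01.
have -> : power_rule rhobar rm (1 - v) = rhobar - p by lra.
have -> : p / rhobar * h + (rhobar - p) / rhobar * l - c =
    p / rhobar * (h - c) + (rhobar - p) / rhobar * (l - c) by field; lra.
have t01 : 0 <= p / rhobar <= 1 by rewrite divr_ge0 ?ler_pdivrMr//; lra.
have u01 : 0 <= (rhobar - p) / rhobar <= 1.
  by rewrite divr_ge0 ?ler_pdivrMr//; lra.
(* Bounding each weight by 1 gives the sum of the two distances, which suffices for the limit. *)
rewrite (le_trans (ler_normD _ _))// lerD// normrM ler_piMl// ger0_norm; lra.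
Qed.

(** * Limits of the platforms *)

Lemma nu_cvg (R : realType) (U : R -> R) (rhobar t : R) :
  0 < rhobar -> {within `[0, rhobar], continuous U} ->
  0 <= t <= 1 -> t != 2^-1 ->
  nu U rhobar rm t @[rm --> rhobar^'-] --> (if t < 2^-1 then U 0 else U rhobar).
Proof.
move=> r0 hUc t01 tN; rewrite -(fun_if U); set l := if _ then _ else _.
have lI : `[0, rhobar]%classic l.
  by rewrite /l /= in_itv /=; case: ifP => _; rewrite lexx ltW.
have pl : power_rule rhobar rm t @[rm --> rhobar^'-] --> l.
  (* Away from the tie [t = 2^-1], where the rule stays at [rhobar / 2], it is affine in [rm], so
     the two-sided limit exists. *)
  rewrite /power_rule (negbTE tN) /l; apply: cvg_at_left_filter.
  have e : (rhobar - rm) * t @[rm --> rhobar] --> (0 : R).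
    rewrite -[0 in X in _ --> X](mul0r t) -(subrr rhobar).
    by apply: cvgMl; apply: cvgB; [exact: cvg_cst|exact: cvg_id].
  case: ifP => // _; rewrite -[X in _ --> X](add0r rhobar).
  by apply: cvgD; [exact: e|exact: cvg_id].
apply: (@cvg_comp _ _ _ _ _ _ (within `[0, rhobar]%classic (nbhs l))) => //;
  last exact: within_continuous_cvg.
(* The limit [l] is an endpoint of [[0, rhobar]], so the power must be shown to stay inside; this
   holds once [0 <= rm < rhobar]. *)
move=> A /pl /= lA.
near=> rm.
have : `[0, rhobar]%classic (power_rule rhobar rm t).
  by apply: power_rule_itv => //; apply/andP; split; near: rm;
    [exact: nbhs_left_ge|exact: nbhs_left_lt].
by near: rm; exact: lA.
Unshelve. all: by end_near. Qed.

Section platforms.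
Context (R : realType) (n : nat) (x s : 'I_n.+1 -> R) (U : R -> R) (rhobar : R).
Variable m : 'I_n.+1.
Hypotheses (s0 : forall i, 0 < s i) (s1 : \sum_(i < n.+1) s i = 1).
Hypotheses (r0 : 0 < rhobar) (hUc : {within `[0, rhobar], continuous U}).
Hypothesis U1 : U rhobar - U 0 = 1.
Hypothesis hm : share_below s m < 2^-1 < share_below s m.+1.

Let below_lt k : (share_below s k < 2^-1) = (k <= m)%N.
Proof.
have [km|mk] := leqP k m.
  by apply: le_lt_trans (share_below_mono s0 km) _; case/andP: hm.
apply/negbTE; rewrite -leNgt ltW//.
by apply: lt_le_trans (share_below_mono s0 mk); case/andP: hm.
Qed.

Let below_neq k : share_below s k != 2^-1.
Proof.
have [km|mk] := leqP k m; first by rewrite lt_eqF// below_lt.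
rewrite gt_eqF//.
by apply: lt_le_trans (share_below_mono s0 mk); case/andP: hm.
Qed.

Lemma platform_low_cvg : platform_low x s U rhobar rm @[rm --> rhobar^'-] --> x m.
Proof.
have lim k : nu U rhobar rm (share_below s k) @[rm --> rhobar^'-] -->
    (if (k <= m)%N then U 0 else U rhobar).
  rewrite -below_lt; apply: nu_cvg => //; exact: share_below_itv.
(* In the limit the weights are the increments of a step function that jumps between the indices [m]
   and [m.+1]: only type [m] keeps a weight, equal to [U rhobar - U 0 = 1]. *)
have -> : x m = \sum_(i < n.+1) ((if (i.+1 <= m)%N then U 0 else U rhobar)
                               - (if (i <= m)%N then U 0 else U rhobar)) * x i.
  rewrite (bigD1 m)//= ltnn leqnn U1 mul1r big1 ?addr0// => i im.
  by rewrite ltn_neqAle im /= subrr mul0r.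
apply: cvg_big; first exact: add_continuous.
by move=> i _; apply: cvgMl; apply: cvgB; exact: lim.
Qed.

Lemma platform_high_cvg :
  platform_high x s U rhobar rm @[rm --> rhobar^'-] --> x m.
Proof.
have fb k : share_from s k = 1 - share_below s k.
  by rewrite (share_below_from k s1) subKr.
have lim k : nu U rhobar rm (share_from s k) @[rm --> rhobar^'-] -->
    (if (k <= m)%N then U rhobar else U 0).
  have -> : (if (k <= m)%N then U rhobar else U 0) =
      if share_from s k < 2^-1 then U 0 else U rhobar.
    (* Complementing reverses the comparison with 1/2; [below_neq] excludes the tie, where this
       reversal would fail. *)
    rewrite -below_lt fb; have := below_neq k.
    by case: ltgtP => // h _; case: ltP => // h'; lra.
  have k01 := share_below_itv k s0 s1.
  apply: nu_cvg => //; first by rewrite fb; lra.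
  by apply/eqP => e; have /eqP := below_neq k; apply; move: e; rewrite fb; lra.
have -> : x m = \sum_(i < n.+1) ((if (i <= m)%N then U rhobar else U 0)
                         - (if (i.+1 <= m)%N then U rhobar else U 0)) * x i.
  rewrite (bigD1 m)//= ltnn leqnn U1 mul1r big1 ?addr0// => i im.
  by rewrite [(i < m)%N]ltn_neqAle im /= subrr mul0r.
apply: cvg_big; first exact: add_continuous.
by move=> i _; apply: cvgMl; apply: cvgB; exact: lim.
Qed.

Lemma platforms_dist_cvg :
  `|platform_high x s U rhobar rm - x m| + `|platform_low x s U rhobar rm - x m|
    @[rm --> rhobar^'-] --> 0.
Proof.
have z (f : R -> R) : f rm @[rm --> rhobar^'-] --> x m ->
    `|f rm - x m| @[rm --> rhobar^'-] --> 0.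
  move=> fx; rewrite -[0 in X in _ --> X](normr0 R) -(subrr (x m)).
  by apply: cvg_norm; apply: cvgB => //; exact: cvg_cst.
rewrite -[0 in X in _ --> X](addr0 0).
by apply: cvgD; apply: z; [exact: platform_high_cvg|exact: platform_low_cvg].
Qed.

(** The shock is quantified inside the filter, which makes the estimate uniform in it; [rm] must be
    near [rhobar] to be nonnegative. *)
Lemma implemented_policy_near : \forall rm \near rhobar^'-,
  forall e, `|implemented_policy x s U rhobar rm e - x m| <=
    `|platform_high x s U rhobar rm - x m| + `|platform_low x s U rhobar rm - x m|.
Proof.
near=> rm => e; apply: implemented_policy_dist => //; first by move=> i; exact: ltW.
by apply/andP; split; near: rm; [exact: nbhs_left_ge|exact: nbhs_left_lt].
Unshelve. all: by end_near. Qed.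

End platforms.

Theorem mainTheorem18 (R : realType) (n : nat) (hn : (2 <= n.+1)%N)
    (x s : 'I_n.+1 -> R)
    (hx : forall i j : 'I_n.+1, (i < j)%N -> x i < x j)
    (hs : forall i, 0 < s i) (hs1 : \sum_(i < n.+1) s i = 1)
    (phi : R)
    (hphi : forall a b i, a \in `[x ord0, x ord_max] ->
       b \in `[x ord0, x ord_max] -> `|Delta x i a b| < phi)
    (d : measure_display) (Omega : measurableType d) (P : probability Omega R)
    (eps : {RV P >-> R}) (heps : is_uniform eps (- phi) phi)
    (rhobar : R) (hrhobar : 0 < rhobar) (U : R -> R)
    (hUc : {within `[0, rhobar], continuous U})
    (hUi : forall y z, y \in `[0, rhobar] -> z \in `[0, rhobar] ->
       y < z -> U y < U z)
    (hUv : strictly_concave_on 0 rhobar U)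
    (hU1 : U rhobar - U 0 = 1)
    (m : 'I_n.+1)
    (hm : \sum_(i < n.+1 | (i < m)%N) s i < 2^-1
          < \sum_(i < n.+1 | (i <= m)%N) s i) :
  [/\ {ae P, forall w : Omega,
         implemented_policy x s U rhobar rm (eps w) @[rm --> rhobar^'-]
           --> x m},
      ('V_P[(fun w => implemented_policy x s U rhobar rm (eps w))])%E
        @[rm --> rhobar^'-] --> 0%:E,
      expected_welfare x s U rhobar rm eps @[rm --> rhobar^'-]
        --> (welfare x s (xopt x s) - (x m - xopt x s) ^+ 2)%:E
    & x m = xopt x s ->
      expected_welfare x s U rhobar rm eps @[rm --> rhobar^'-]
        --> (welfare x s (xopt x s))%:E].
Proof.
have hm' : share_below s m < 2^-1 < share_below s m.+1 by [].
set D := fun rm => `|platform_high x s U rhobar rm - x m|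
                 + `|platform_low x s U rhobar rm - x m|.
have D0 : D rm @[rm --> rhobar^'-] --> 0 by exact: platforms_dist_cvg.
have XD : \forall rm \near rhobar^'-,
    forall e, `|implemented_policy x s U rhobar rm e - x m| <= D rm.
  exact: implemented_policy_near.
have mX rm : measurable_fun setT
    (fun w => implemented_policy x s U rhobar rm (eps w)).
  by apply: measurableT_comp => //; exact: measurable_implemented_policy.
have W : expected_welfare x s U rhobar rm eps @[rm --> rhobar^'-]
    --> (welfare x s (xopt x s) - (x m - xopt x s) ^+ 2)%:E.
  (* The target becomes the welfare at [x m], a constant from which the gap can be bounded
     uniformly. *)
  rewrite -welfare_xopt//.
  apply: (@expectation_cvg _ _ _ _ _ _ _ _ _
    (fun rm => D rm * (D rm + 2 * `|x m - xopt x s|))).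
  - move=> rm; rewrite (_ : (fun w => _) = fun w => welfare x s (xopt x s)
        - (implemented_policy x s U rhobar rm (eps w) - xopt x s) ^+ 2);
      last by apply/funext => w; exact: welfare_xopt.
    apply: measurable_funB; first exact: measurable_cst.
    by apply: measurable_funX; apply: measurable_funB.
  - apply: filterS XD => rm h w; have := h (eps w).
    set X := implemented_policy _ _ _ _ _ _ => hX.
    rewrite (welfare_xopt x X hs1) (welfare_xopt x (x m) hs1).
    set c := xopt x s.
    (* Factoring the difference of squares through [X - x m] yields the chosen bound
       [D rm * (D rm + 2 * |x m - xopt x s|)]. *)
    have -> : welfare x s c - (X - c) ^+ 2 - (welfare x s c - (x m - c) ^+ 2) =
        - ((X - x m) * ((X - x m) + 2 * (x m - c))) by ring.
    rewrite normrN normrM ler_pM// (le_trans (ler_normD _ _))// lerD//.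
    by rewrite normrM ger0_norm.
  - rewrite -[0 in X in _ --> X](mul0r (0 + 2 * `|x m - xopt x s|)).
    by apply: cvgM => //; apply: cvgD => //; exact: cvg_cst.
(* Convergence holds at every outcome, hence almost surely. *)
split=> //.
- apply: aeW => w; apply/cvgrPdist_le => e e0.
  have De : \forall rm \near rhobar^'-, D rm <= e.
    by apply: filterS (cvgr0_norm_le _ D0 e e0) => rm /(le_trans (ler_norm _)).
  by apply: filterS2 XD De => rm h; rewrite distrC; exact: le_trans.
- by apply: variance_cvg0 mX _ D0; apply: filterS XD => rm h w; exact: h.
- by move=> e; move: W; rewrite e subrr expr0n subr0.
Qed.
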